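(* Let $\pi\in(0,\tfrac12)$, $m=\|\mu\|_2>0$, $\delta>0$ with $\delta<\delta^*(0)$, and let $\tau^{\rm opt}>0$ be the optimal margin ratio, i.e. the minimizer over $\tau$ of the asymptotic balanced error $\mathrm{Err}_{\rm b}^*=\frac12\{\Phi(-\rho^*\|\mu\|_2-\beta_0^* )+\Phi(-\rho^*\|\mu\|_2+\beta_0^* )\}$ of the margin-rebalanced SVM with hyperparameter $\tau$. Let $g_1(x)=\mathbb E[(G+x)_+]$ with $G\sim\mathsf N(0,1)$. Then $$\tau^{\rm opt}=\frac{g_1^{-1}\!\left(\dfrac{\rho^*}{2\pi\|\mu\|_2\delta}\right)+\rho^*\|\mu\|_2}{g_1^{-1}\!\left(\dfrac{\rho^*}{2(1-\pi)\|\mu\|_2\delta}\right)+\rho^*\|\mu\|_2}.$$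
   Context: Let $(Y,G)$ be independent, $\mathbb P(Y=+1)=\pi=1-\mathbb P(Y=-1)$, $G\sim\mathsf N(0,1)$; $s(+1)=\tau$, $s(-1)=1$; $a_+=\max\{a,0\}$; $\Phi$ the standard normal CDF. Define $$H_\kappa(\rho,\beta_0)=\frac{1-\rho^2}{\mathbb E[(s(Y)\kappa-\rho\|\mu\|_2+G-\beta_0Y)_+^2]},\qquad \delta^*(\kappa)=\max_{\rho\in[-1,1],\,\beta_0\in\mathbb R}H_\kappa(\rho,\beta_0);$$ $\delta^*(0)$ does not depend on $\tau$. For $\delta<\delta^*(0)$ and $\tau\in(0,\infty)$, $(\rho^*,\beta_0^*,\kappa^* )$ denotes the unique solution of: maximize $\kappa$ over $\rho\in[-1,1],\beta_0\in\mathbb R,\kappa\in\mathbb R$ subject to $H_\kappa(\rho,\beta_0)\ge\delta$; here $\rho^*\in(0,1)$ does not depend on $\tau$ while $\beta_0^*$ does. (These are the high-dimensional limits, $n/d\to\delta$, of the cosine with $\mu$, intercept and margin of the SVM maximizing $\kappa$ subject to $y_i(\langle x_i,\beta\rangle+\beta_0)\ge s(y_i)\kappa$, $\|\beta\|_2\le1$, for data $\mathbb P(y_i=+1)=\pi$, $x_i\mid y_i\sim\mathsf N(y_i\mu,I_d)$.) $g_1$ is a strictly increasing bijection from $\mathbb R$ to $(0,\infty)$. *)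

(* Defs.v *)
From HB Require Import structures.
From mathcomp Require Import all_boot all_order all_algebra.
From mathcomp Require Import all_classical all_reals all_analysis.

Set Implicit Arguments.
Unset Strict Implicit.
Unset Printing Implicit Defensive.

Import Order.TTheory GRing.Theory Num.Theory.
Import numFieldNormedType.Exports.

Local Open Scope classical_set_scope.
Local Open Scope ring_scope.

Section definitions.
Context {R : realType}.

Definition pos_part (a : R) : R := Num.max a 0.

(* Labels are reals in {-1, 1}; the value at other reals is irrelevant. *)
Definition margin_scale (tau y : R) : R := if y == 1 then tau else 1.

Definition Phi (x : R) : R := fine (normal_prob 0 1 `]-oo, x]).

Section random_variables.
Context {d : measure_display} {T : measurableType d} (P : probability T R).

Definition independent_RV (X Z : {RV P >-> R}) : Prop :=
  forall A B : set R, measurable A -> measurable B ->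
    P (X @^-1` A `&` Z @^-1` B) = (P (X @^-1` A) * P (Z @^-1` B))%E.

Definition standard_normal (X : {RV P >-> R}) : Prop :=
  forall A : set R, measurable A -> distribution P X A = normal_prob 0 1 A.

Definition label_law (p : R) (Y : {RV P >-> R}) : Prop :=
  P (Y @^-1` [set 1]) = p%:E /\ P (Y @^-1` [set -1]) = (1 - p)%:E.

(* The dependence on the mean vector mu is only through m = ||mu||_2. *)
Definition H (Y G : {RV P >-> R}) (m tau kappa rho beta0 : R) : R :=
  (1 - rho ^+ 2) /
  fine ('E_P[fun w => pos_part (margin_scale tau (Y w) * kappa - rho * m
                                + G w - beta0 * Y w) ^+ 2]).

(* The maximum is attained, so it is the supremum. *)
Definition delta_star (Y G : {RV P >-> R}) (m tau kappa : R) : R :=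
  sup [set H Y G m tau kappa rho beta0 | rho in `[-1, 1] & beta0 in setT].

Definition svm_feasible (Y G : {RV P >-> R}) (m delta tau : R)
    (rho beta0 kappa : R) : Prop :=
  -1 <= rho <= 1 /\ delta <= H Y G m tau kappa rho beta0.

Definition svm_solution (Y G : {RV P >-> R}) (m delta tau : R)
    (rho beta0 kappa : R) : Prop :=
  svm_feasible Y G m delta tau rho beta0 kappa /\
  forall rho' beta0' kappa' : R,
    svm_feasible Y G m delta tau rho' beta0' kappa' -> kappa' <= kappa.

Definition g1 (G : {RV P >-> R}) (x : R) : R :=
  fine ('E_P[fun w => pos_part (G w + x)]).

(* pinv setT f is the inverse of f on its range when f is injective. *)
Definition g1_inv (G : {RV P >-> R}) : R -> R := pinv setT (g1 G).

End random_variables.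

Definition balanced_error (m rho beta0 : R) : R :=
  2^-1 * (Phi (- rho * m - beta0) + Phi (- rho * m + beta0)).

End definitions.

(* Main.v *)
Require Import Defs.
From mathcomp Require Import all_boot all_order all_algebra.
From mathcomp Require Import all_classical all_reals all_analysis.
From mathcomp Require Import measurable_realfun ring lra.

Import Order.TTheory GRing.Theory Num.Theory.
Import numFieldNormedType.Exports.
Local Open Scope classical_set_scope.
Local Open Scope ring_scope.

(* With a = tau kappa - rho m - beta0 and b = kappa - rho m + beta0, the
   constraint H >= delta reads
     delta (p E(G+a)_+^2 + (1-p) E(G+b)_+^2) + rho^2 <= 1
   and (1 + tau) kappa = a + b + 2 rho m, so the maximizer (rho, a, b) does not
   depend on tau.  The gradient condition gives rho = 2 m delta p g1(a)
   = 2 m delta (1-p) g1(b).  The intercept is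
     beta0 = (tau (b + rho m) - (a + rho m)) / (1 + tau),
   strictly increasing in tau because kappa > 0.  As rho > 0, the balanced
   error is strictly increasing in |beta0|; hence beta0 = 0 at the optimal tau,
   that is, tau = (a + rho m) / (b + rho m). *)

(** * Gaussian distribution function and truncated Gaussian moments *)

Section Gaussian.
Context {R : realType}.
Local Notation mu := (@lebesgue_measure R).
Local Notation nu := (@normal_prob R 0 1).
Local Notation phi := (@normal_pdf R 0 1).

Lemma normal_pdf01_lt (x y : R) : `|x| < `|y| -> phi y < phi x.
Proof.
move=> xy; rewrite /normal_pdf oner_eq0 ltr_pM2l ?normal_peak_gt0 ?oner_neq0//.
rewrite ltr_expR !subr0 expr1n !mulNr ltrN2 ltr_pM2r ?invr_gt0//.
by rewrite -(real_normK (num_real x)) -(real_normK (num_real y)) ltrXn2r.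
Qed.

Lemma normal_pdf01_gt0 (x : R) : 0 < phi x.
Proof.
by rewrite /normal_pdf oner_eq0 mulr_gt0 ?normal_peak_gt0 ?oner_neq0 ?expR_gt0.
Qed.

Lemma is_derive_Phi (x : R) : is_derive x 1 (@Phi R) (phi x).
Proof.
have [|||| d1 d2] := @continuous_FTC1 R phi -oo%O x (x + 1).
- by rewrite ltrDl.
- apply: integrableS (integrable_normal_pdf 0 1) => //; exact: measurable_itv.
- exact: ltNyr.
- by apply: continuous_normal_pdf; rewrite oner_neq0.
- by apply: DeriveDef; [exact: d1|rewrite -derive1E; exact: d2].
Qed.

(** A null ray would force [Phi (c + 1) = Phi c], whereas [Phi] has positive derivative. *)
Lemma normal_prob_ray_gt0 (c : R) : (0 < nu `[c, +oo[)%E.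
Proof.
rewrite lt0e measure_ge0 andbT; apply/eqP => nu0.
have nuy : (nu `]c, (c + 1)%R] = 0)%E.
  apply/eqP; rewrite eq_le measure_ge0 andbT -nu0.
  apply: le_measure; rewrite ?inE; try exact: measurable_itv.
  by move=> z /=; rewrite !in_itv/= andbT => /andP[/ltW].
have E : (@Phi R (c + 1) = Phi c).
  rewrite /Phi.
  have -> : `]-oo, (c + 1)%R]%classic = `]-oo, c] `|` `]c, (c + 1)%R] :> set R.
    by rewrite -itv_bndbnd_setU// bnd_simp lerDl.
  rewrite measureU//; first by rewrite [X in (_ + X)%E]nuy adde0.
  apply/seteqP; split => z //=; rewrite !in_itv/= => -[zc /andP[cz _]].
  by rewrite ltNge zc in cz.
have : Phi c < @Phi R (c + 1).
  apply: (@gtr0_derive1_incr R Phi c (c + 1)) => //; rewrite ?lexx ?lerDl ?ltrDl//.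
  - by move=> x _; have := is_derive_Phi x => -[].
  - move=> x _; rewrite derive1E; have [_ ->] := is_derive_Phi x.
    exact: normal_pdf01_gt0.
  - apply: continuous_subspaceT => x.
    apply: differentiable_continuous; apply/derivable1_diffP.
    by have [] := is_derive_Phi x.
by rewrite E ltxx.
Qed.

(** The error is even in the intercept. For b > 0 its derivative has the sign of phi (b - rho m) -
    phi (b + rho m), positive because |b - rho m| < b + rho m. *)
Lemma balanced_error_lt (m rho b1 b2 : R) : 0 < rho * m -> `|b1| < `|b2| ->
  balanced_error m rho b1 < balanced_error m rho b2.
Proof.
move=> rm0.
have even (b : R) : balanced_error m rho b = balanced_error m rho `|b|.
  by case: (ger0P b) => // b0; rewrite /balanced_error opprK [X in _ * X]addrC.
rewrite (even b1) (even b2).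
have : 0 <= `|b1| by []; move: (`|b1| : R) (`|b2| : R) => {}b1 {}b2 b10 b12.
rewrite /balanced_error ltr_pM2l ?invr_gt0//.
pose F (b : R) := Phi (- rho * m - b) + Phi (- rho * m + b).
have dF (b : R) : is_derive b 1 F (- phi (- rho * m - b) + phi (- rho * m + b)).
  have d1 := is_derive_Phi (- rho * m - b); have d2 := is_derive_Phi (- rho * m + b).
  have e0 := @is_derive_cst R R^o R^o (- rho * m) b 1.
  have e1 := is_deriveB e0 (is_derive_id b (1 : R^o)).
  have e2 := is_deriveD e0 (is_derive_id b (1 : R^o)).
  have f1 := @is_derive1_comp R (@Phi R) _ b _ _ d1 e1.
  have f2 := @is_derive1_comp R (@Phi R) _ b _ _ d2 e2.
  by have := is_deriveD f1 f2; rewrite sub0r add0r mulrN1 mulr1.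
apply: (@gtr0_derive1_incr R F b1 b2); rewrite ?lexx ?ltW//.
- move=> x; rewrite in_itv/= => /andP[b1x xb2]; rewrite derive1E.
  have [_ ->] := dF x.
  rewrite addrC subr_gt0; apply: normal_pdf01_lt.
  have x0 : 0 < x := le_lt_trans b10 b1x.
  rewrite mulNr -opprD normrN (ger0_norm (addr_ge0 (ltW rm0) (ltW x0))) ltr_norml.
  by apply/andP; split; lra.
- apply: continuous_subspaceT => x.
  apply: differentiable_continuous; apply/derivable1_diffP.
  by have [] := dF x.
Qed.

(** The Radon-Nikodym derivative of [nu] agrees almost everywhere with [phi], since both integrate
    to [nu E] over every measurable E. *)
Lemma ge0_integral_normal_prob (f : R -> R) :
  measurable_fun setT f -> (forall x, 0 <= f x) ->
  (\int[nu]_x (f x)%:E = \int[mu]_x (f x * phi x)%:E)%E.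
Proof.
move=> mf f0.
have dom := @normal_prob_dominates R 0 1.
have /measurable_EFinP mf' := mf.
rewrite -(Radon_Nikodym_SigmaFinite.change_of_variables dom)//; last first.
under [RHS]eq_integral do rewrite EFinM.
have RNi := Radon_Nikodym_SigmaFinite.f_integrable dom.
apply: ae_eq_integral => //.
- by apply: emeasurable_funM => //; exact: measurable_int RNi.
- apply: emeasurable_funM => //; apply/measurable_EFinP.
  exact: measurable_normal_pdf.
- apply: ae_eqe_mul2l; apply: integral_ae_eq => //.
  + by apply/measurable_EFinP; exact: measurable_normal_pdf.
  + by move=> E _ mE; rewrite -(Radon_Nikodym_SigmaFinite.f_integral dom).
Qed.

Lemma integrable_normal_prob_sqr : nu.-integrable setT (fun x : R => (x ^+ 2)%:E).
Proof.
have msqr : measurable_fun [set: R] (fun x : R => x ^+ 2).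
  exact: measurable_funX.
apply/integrableP; split; first exact/measurable_EFinP.
under eq_integral do rewrite gee0_abs ?lee_fin ?sqr_ge0//.
rewrite ge0_integral_normal_prob//; last by move=> x; exact: sqr_ge0.
(* [x ^ 2 * exp (- x ^ 2 / 2) <= 8 / 3 * exp (- x ^ 2 / 8)], so the integrand is
   dominated by a multiple of the density of N(0, 4). *)
pose C : R := 8 / 3 * normal_peak 1 / normal_peak 2.
apply: (@le_lt_trans _ _ (\int[mu]_x (C%:E * (normal_pdf 0 2 x)%:E))%E); last first.
  rewrite integralZl//; last exact: integrable_normal_pdf.
  by rewrite integral_normal_pdf mule1 ltry.
apply: ge0_le_integral => //.
- by move=> x _; rewrite lee_fin mulr_ge0 ?sqr_ge0 ?normal_pdf_ge0.
- by apply/measurable_EFinP/measurable_funM => //; exact: measurable_normal_pdf.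
- by apply/measurable_EFinP/measurable_funM => //; exact: measurable_normal_pdf.
- move=> x _; rewrite -EFinM lee_fin /normal_pdf oner_eq0 pnatr_eq0/=.
  have p1 : 0 < normal_peak 1 :> R by apply: normal_peak_gt0; rewrite oner_neq0.
  have p2 : 0 < normal_peak 2 :> R by apply: normal_peak_gt0; rewrite pnatr_eq0.
  rewrite /C /normal_fun !subr0.
  set t := x ^+ 2.
  (* Splitting off exp (- 3 t / 8) leaves the exponent of N(0, 4); then exp (3 t / 8) >= 1 + 3 t / 8
     gives t / exp (3 t / 8) <= 8 / 3. *)
  have -> : - t / (1 ^+ 2 *+ 2) = - t / (2 ^+ 2 *+ 2) + - (3 / 8 * t) by field.
  rewrite expRD expRN.
  have := expR_ge1Dx (3 / 8 * t); set e := expR (3 / 8 * t) => et.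
  have e0 : 0 < e by exact: expR_gt0.
  set e' := expR _.
  have e'0 : 0 < e' by exact: expR_gt0.
  have -> : t * (normal_peak 1 * (e' / e)) = (t / e) * (normal_peak 1 * e').
    by field; rewrite gt_eqF.
  have -> : 8 / 3 * normal_peak 1 / normal_peak 2 * (normal_peak 2 * e') =
      8 / 3 * (normal_peak 1 * e').
    by field; rewrite gt_eqF.
  by rewrite ler_pM2r ?mulr_gt0// ler_pdivrMr//; lra.
Qed.

Lemma integrable_normal_prob_id : nu.-integrable setT (fun x : R => x%:E).
Proof.
have i1 := finite_measure_integrable_cst nu 1 measurableT.
have i2 := integrableD measurableT i1 integrable_normal_prob_sqr.
apply: le_integrable i2 => //; first exact/measurable_EFinP.
move=> x _; rewrite -EFinD !abse_EFin lee_fin.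
rewrite [leRHS]ger0_norm ?addr_ge0 ?sqr_ge0//= ler_norml.
have := sqr_ge0 (x - 1); have := sqr_ge0 (x + 1).
by move=> ? ?; apply/andP; split; nra.
Qed.

(* [relu1] is the paper's g_1, expressed without the probability space. *)
Definition relu1 (x : R) : R := \int[nu]_y pos_part (y + x).
Definition relu2 (x : R) : R := \int[nu]_y pos_part (y + x) ^+ 2.

Lemma pos_partE (u : R) : pos_part u = if 0 <= u then u else 0.
Proof. by rewrite /pos_part maxC /Num.max; case: ltrgt0P. Qed.

(** On the ray z >= - x neither positive part truncates. That ray has positive mass, which is what
    makes [relu1] strictly increasing. *)
Lemma pos_part_sub_ge (x y z : R) : x < y ->
  (if - x <= z then y - x else 0) <= pos_part (z + y) - pos_part (z + x).
Proof.
move=> xy; rewrite !pos_partE.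
by case: (lerP (- x) z) => ?; case: (lerP 0 (z + y)) => ?;
  case: (lerP 0 (z + x)) => ?; lra.
Qed.

(** The square of the positive part is convex, with 2-Lipschitz derivative twice the positive part:
    it lies between its tangent and its tangent plus t ^ 2. *)
Lemma pos_part_sqr_le (x t y : R) : pos_part (y + (x + t)) ^+ 2 <=
  pos_part (y + x) ^+ 2 + (2 * t * pos_part (y + x) + t ^+ 2).
Proof.
rewrite !pos_partE.
by case: (lerP 0 (_ + (_ + _))) => ?; case: (lerP 0 (_ + _)) => ?; nra.
Qed.

Lemma pos_part_sqr_ge (x t y : R) :
  pos_part (y + x) ^+ 2 + 2 * t * pos_part (y + x) <= pos_part (y + (x + t)) ^+ 2.
Proof.
rewrite !pos_partE.
by case: (lerP 0 (_ + (_ + _))) => ?; case: (lerP 0 (_ + _)) => ?; nra.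
Qed.

Lemma pos_part_ge0 (u : R) : 0 <= pos_part u.
Proof. by rewrite le_max lexx orbT. Qed.

Lemma pos_part_le_norm (u : R) : pos_part u <= `|u|.
Proof. by rewrite ge_max ler_norm normr_ge0. Qed.

Lemma measurable_pos_part : measurable_fun [set: R] (@pos_part R).
Proof. by apply: measurable_maxr => //; exact: measurable_cst. Qed.

Lemma measurable_pos_part_addr (x : R) :
  measurable_fun [set: R] (fun y : R => pos_part (y + x)).
Proof.
by apply: measurableT_comp; [exact: measurable_pos_part|exact: measurable_funD].
Qed.

Lemma integrable_relu1 (x : R) :
  nu.-integrable setT (EFin \o (fun y : R => pos_part (y + x))).
Proof.
have i1 := finite_measure_integrable_cst nu x measurableT.
have i2 := integrableD measurableT integrable_normal_prob_id i1.
apply: le_integrable i2 => //.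
  by apply/measurable_EFinP; exact: measurable_pos_part_addr.
move=> y _; rewrite -EFinD !abse_EFin lee_fin.
by rewrite ger0_norm ?pos_part_ge0// pos_part_le_norm.
Qed.

Lemma integrable_relu2 (x : R) :
  nu.-integrable setT (EFin \o (fun y : R => pos_part (y + x) ^+ 2)).
Proof.
(* The dominating function comes from (y + x) ^ 2 <= 2 y ^ 2 + 2 x ^ 2. *)
have i1 := finite_measure_integrable_cst nu (2 * x ^+ 2) measurableT.
have i0 := integrableZl measurableT 2 integrable_normal_prob_sqr.
have i2 := integrableD measurableT i0 i1.
apply: le_integrable i2 => //.
  apply/measurable_EFinP; apply: measurable_funX.
  exact: measurable_pos_part_addr.
move=> y _; rewrite -EFinM -EFinD !abse_EFin lee_fin/=.
rewrite [leRHS]ger0_norm; last by apply: addr_ge0; apply: mulr_ge0; rewrite ?sqr_ge0.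
rewrite ger0_norm ?sqr_ge0//.
apply: (@le_trans _ _ (`|y + x| ^+ 2)).
  by rewrite ler_pXn2r ?nnegrE ?pos_part_ge0 ?pos_part_le_norm.
by rewrite real_normK ?num_real//; have := sqr_ge0 (y - x); nra.
Qed.

Lemma relu1_incr : {homo relu1 : x y / x < y}.
Proof.
move=> x y xy; rewrite -subr_gt0 /relu1 -RintegralB//; try exact: integrable_relu1.
have := normal_prob_ray_gt0 (- x).
have : nu `[- x, +oo[ \is a fin_num by apply: fin_num_measure.
move=> /fineK <-; rewrite lte_fin => nu0.
have yx0 : 0 < y - x by rewrite subr_gt0.
apply: (lt_le_trans (mulr_gt0 yx0 nu0)).
rewrite -Rintegral_cst// Rintegral_mkcond; apply: le_Rintegral => //.
- rewrite -restrict_EFin -integrable_mkcond//.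
  exact: finite_measure_integrable_cst.
- exact: (integrableB measurableT (integrable_relu1 y) (integrable_relu1 x)).
- move=> z _; rewrite patchE mem_setE in_itv/= andbT.
  exact: pos_part_sub_ge.
Qed.

Lemma relu1_gt0 (x : R) : 0 < relu1 x.
Proof.
apply: le_lt_trans (@relu1_incr (x - 1) x _); last by rewrite ltrBlDr ltrDl.
by apply: Rintegral_ge0 => y _; exact: pos_part_ge0.
Qed.

Lemma relu_affine (x c k : R) :
  nu.-integrable setT
    (EFin \o (fun y : R => pos_part (y + x) ^+ 2 + (c * pos_part (y + x) + k))) /\
  \int[nu]_y (pos_part (y + x) ^+ 2 + (c * pos_part (y + x) + k)) =
    relu2 x + (c * relu1 x + k).
Proof.
have ik := finite_measure_integrable_cst nu k measurableT.
have i1 := integrableZl measurableT c (integrable_relu1 x).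
have i1k := integrableD measurableT i1 ik.
have i2 := integrableD measurableT (integrable_relu2 x) i1k.
split; first exact: i2.
rewrite (RintegralD measurableT (integrable_relu2 x) i1k).
rewrite (RintegralD measurableT i1 ik).
rewrite (RintegralZl _ measurableT (integrable_relu1 x)).
by rewrite Rintegral_cst// [X in fine X]probability_setT mulr1.
Qed.

(* The derivative of [relu2] is [2 * relu1]; this bound and [relu2_ge] give the
   first-order conditions without differentiating under the integral. *)
Lemma relu2_le (x t : R) : relu2 (x + t) <= relu2 x + 2 * t * relu1 x + t ^+ 2.
Proof.
rewrite -addrA; have [i <-] := relu_affine x (2 * t) (t ^+ 2).
apply: le_Rintegral => //; first exact: integrable_relu2.
by move=> y _; exact: pos_part_sqr_le.
Qed.

Lemma relu2_ge (x t : R) : relu2 x + 2 * t * relu1 x <= relu2 (x + t).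
Proof.
rewrite -[_ * relu1 _]addr0; have [i <-] := relu_affine x (2 * t) 0.
apply: le_Rintegral => //; first exact: integrable_relu2.
by move=> y _; rewrite addr0; exact: pos_part_sqr_ge.
Qed.

Lemma relu2_gt0 (x : R) : 0 < relu2 x.
Proof.
(* The tangent bound at x - 1 has the strictly positive slope [2 * relu1 (x - 1)]. *)
have := relu2_ge (x - 1) 1; rewrite subrK; apply: lt_le_trans.
rewrite ltr_wpDl ?mulr_gt0 ?relu1_gt0//.
by apply: Rintegral_ge0 => y _; exact: sqr_ge0.
Qed.

End Gaussian.

(** * The program in (rho, a, b): a linear gain under a convex budget *)

Section ReducedProgram.
Context {R : realType}.
Implicit Types A B m rho a b t : R.

Definition budget A B rho a b := A * relu2 a + B * relu2 b + rho ^+ 2.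

Definition gain m rho a b := a + b + 2 * rho * m.

Definition reduced_optimum A B m rho a b :=
  budget A B rho a b <= 1 /\
  forall rho' a' b', budget A B rho' a' b' <= 1 ->
    gain m rho' a' b' <= gain m rho a b.

Lemma budget_step A B rho a b (r u v t : R) : 0 <= A -> 0 <= B ->
  budget A B (rho + t * r) (a + t * u) (b + t * v) <=
  budget A B rho a b + t * (2 * (A * u * relu1 a + B * v * relu1 b + rho * r))
    + t ^+ 2 * (A * u ^+ 2 + B * v ^+ 2 + r ^+ 2).
Proof.
move=> A0 B0; rewrite /budget.
have := ler_wpM2l A0 (relu2_le a (t * u)).
have := ler_wpM2l B0 (relu2_le b (t * v)).
lra.
Qed.

(** A short step along a direction of first-order budget decrease stays feasible, and the gain is
    linear, so optimality forbids an increase. *)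
Lemma reduced_optimum_direction A B m rho a b (r u v : R) : 0 <= A -> 0 <= B ->
  reduced_optimum A B m rho a b ->
  A * u * relu1 a + B * v * relu1 b + rho * r < 0 -> gain m r u v <= 0.
Proof.
move=> A0 B0 [feas opt]; set D := _ + _ => D0.
set M := A * u ^+ 2 + B * v ^+ 2 + r ^+ 2.
have M0 : 0 <= M.
  by apply: addr_ge0; [apply: addr_ge0; apply: mulr_ge0|]; rewrite ?sqr_ge0.
(* By [budget_step] the budget changes by at most 2 t D + t ^ 2 M, which equals t (D - t) < 0 for
   this t. *)
pose t := - D / (M + 1).
have t0 : 0 < t by rewrite /t divr_gt0 ?oppr_gt0 ?ltr_wpDl.
have tM : t * (M + 1) = - D by rewrite /t divfK// gt_eqF// ltr_wpDl.
have := opt (rho + t * r) (a + t * u) (b + t * v).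
have -> : budget A B (rho + t * r) (a + t * u) (b + t * v) <= 1.
  apply: le_trans (budget_step _ _ _ _ _ _ _ _ _ A0 B0) _; rewrite -/D -/M.
  nra.
move=> /(_ isT); rewrite /gain; nra.
Qed.

(** Any slack could be spent on increasing a alone, which raises the gain. *)
Lemma reduced_optimum_tight A B m rho a b : 0 < A -> 0 <= B ->
  reduced_optimum A B m rho a b -> budget A B rho a b = 1.
Proof.
move=> A0 B0 [feas opt]; apply/eqP; rewrite eq_le feas /= leNgt; apply/negP => lt1.
have D0 : 0 < 2 * (A * relu1 a) by rewrite !mulr_gt0 ?relu1_gt0.
set D := 2 * _ in D0; pose s := 1 - budget A B rho a b.
have s0 : 0 < s by rewrite subr_gt0.
(* As t <= 1, the cost t D + t ^ 2 A of the step is at most t (D + A) = s - t s, below the slack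
   s. *)
pose t := s / (s + D + A).
have q0 : 0 < s + D + A by rewrite addr_gt0// addr_gt0.
have t0 : 0 < t by rewrite divr_gt0.
have tq : t * (s + D + A) = s by rewrite /t divfK// gt_eqF.
have t1 : t <= 1 by rewrite /t ler_pdivrMr//; lra.
have := opt (rho + t * 0) (a + t * 1) (b + t * 0).
have -> : budget A B (rho + t * 0) (a + t * 1) (b + t * 0) <= 1.
  apply: le_trans (budget_step _ _ _ _ _ _ _ _ _ (ltW A0) B0) _.
  have -> : budget A B rho a b = 1 - s by rewrite /s; ring.
  have -> : 2 * (A * 1 * relu1 a + B * 0 * relu1 b + rho * 0) = D.
    by rewrite /D; ring.
  have : t ^+ 2 * A <= t * A.
    by apply: ler_wpM2r; [exact: ltW|rewrite expr2 ler_piMl // ltW].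
  have : 0 < t * s by rewrite mulr_gt0.
  rewrite expr1n expr0n /=; lra.
move=> /(_ isT); rewrite /gain; lra.
Qed.

(** Directions of nonnegative gain cannot have negative budget slope; applied to zero-gain
    directions and their opposites, this yields equalities. *)
Lemma reduced_optimum_gradient A B m rho a b : 0 < A -> 0 < B ->
  reduced_optimum A B m rho a b ->
  rho = 2 * m * (A * relu1 a) /\ rho = 2 * m * (B * relu1 b).
Proof.
move=> A0 B0 opt.
have Ag : 0 < A * relu1 a by rewrite mulr_gt0 ?relu1_gt0.
have nonneg (r u v : R) : 0 <= gain m r u v ->
    0 <= A * u * relu1 a + B * v * relu1 b + rho * r.
  move=> g0; rewrite leNgt; apply/negP; set D := _ + _ => D0.
  (* Adding e to u makes the gain strictly positive and only halves the slope D, which remains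
     negative. *)
  pose e := - D / (2 * (A * relu1 a)).
  have e0 : 0 < e by rewrite divr_gt0 ?oppr_gt0// mulr_gt0.
  have eD : e * (A * relu1 a) = - D / 2.
    by rewrite /e; move: (A * relu1 a) Ag => c /gt_eqF c0; field; rewrite c0.
  have := @reduced_optimum_direction A B m rho a b r (u + e) v (ltW A0) (ltW B0) opt.
  have -> : A * (u + e) * relu1 a + B * v * relu1 b + rho * r = D / 2.
    by transitivity (D + e * (A * relu1 a)); [rewrite /D; ring|rewrite eD; field].
  by move: g0; rewrite /gain => g0 /(_ ltac:(lra)); lra.
(* The directions (r, u, v) = (0, 1, -1) and (1, - 2 m, 0) span the kernel of the gain. *)
have := nonneg 0 1 (- 1) ltac:(rewrite /gain; lra).
have := nonneg 0 (- 1) 1 ltac:(rewrite /gain; lra).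
have := nonneg 1 (- (2 * m)) 0 ltac:(rewrite /gain; lra).
have := nonneg (- 1) (2 * m) 0 ltac:(rewrite /gain; lra).
move=> h1 h2 h3 h4; have AB : A * relu1 a = B * relu1 b by lra.
by rewrite -AB; split; lra.
Qed.

Lemma relu1_inj : injective (@relu1 R).
Proof.
move=> x y xy; apply/eqP; rewrite eq_le !leNgt.
by apply/andP; split; apply/negP => /relu1_incr; rewrite xy ltxx.
Qed.

(* Strong convexity of the budget in rho forces equality of the rho's; the
   gradient condition then recovers a and b from rho. *)
Lemma reduced_optimum_unique A B m rho a b rho' a' b' : 0 < A -> 0 < B -> 0 < m ->
  reduced_optimum A B m rho a b -> reduced_optimum A B m rho' a' b' ->
  [/\ rho = rho', a = a' & b = b'].
Proof.
move=> A0 B0 m0 opt opt'.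
have [Ea Eb] := reduced_optimum_gradient _ _ _ _ _ _ A0 B0 opt.
have [Ea' Eb'] := reduced_optimum_gradient _ _ _ _ _ _ A0 B0 opt'.
have tight := reduced_optimum_tight _ _ _ _ _ _ A0 (ltW B0) opt.
have g : gain m rho a b = gain m rho' a' b'.
  case: opt opt' => feas opt [feas' opt'].
  by apply/eqP; rewrite eq_le opt'//= opt.
have Erho : rho = rho'.
  have := ler_wpM2l (ltW A0) (relu2_ge a (a' - a)).
  have := ler_wpM2l (ltW B0) (relu2_ge b (b' - b)).
  have := opt'.1; move: tight g; rewrite /budget /gain !subrKC => tight g h1 h2 h3.
  have : (rho' - rho) ^+ 2 <= 0.
    (* By the gradient condition the first-order terms are a multiple of the difference of the two
       gains, which is 0. Only the square in rho survives. *)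
    have E : 2 * (a' - a) * (A * relu1 a) + 2 * (b' - b) * (B * relu1 b) +
        2 * (rho' - rho) * rho = 0.
      have -> : B * relu1 b = A * relu1 a by nra.
      transitivity (2 * (A * relu1 a) *
          ((a' + b' + 2 * rho' * m) - (a + b + 2 * rho * m))).
        by rewrite [X in 2 * (rho' - rho) * X]Ea; ring.
      by rewrite -g subrr mulr0.
    nra.
  by rewrite le_eqVlt ltNge sqr_ge0 orbF sqrf_eq0 subr_eq0 => /eqP.
have inj (C x y : R) : 0 < C ->
    2 * m * (C * relu1 x) = 2 * m * (C * relu1 y) -> x = y.
  move=> C0 /mulfI-/(_ ltac:(by rewrite mulf_neq0 ?pnatr_eq0 ?gt_eqF)).
  by move=> /mulfI-/(_ ltac:(by rewrite gt_eqF)) /relu1_inj.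
split=> //.
  by apply: (inj A) => //; rewrite -Ea -Ea'.
by apply: (inj B) => //; rewrite -Eb -Eb'.
Qed.

End ReducedProgram.

(** * Expectations under the law of (Y, G) *)

Section Expectations.
Context {R : realType} {d : measure_display} {T : measurableType d}.
Context (P : probability T R).
Implicit Types (Y G : {RV P >-> R}).

(* [normal_prob] lives on [measurableTypeR R], whose display differs from that of
   the canonical measurable structure on [R] although the measurable sets are
   convertible: hence the pushforward along [G : T -> measurableTypeR R] rather
   than [distribution P G]. *)
Lemma ge0_integral_standard_normal_on Y G (D : set R) (q : R) (f : R -> R) :
  standard_normal G -> independent_RV Y G -> measurable D -> 0 <= q ->
  P (Y @^-1` D) = q%:E ->
  measurable_fun setT f -> (forall x, 0 <= f x) ->
  (\int[P]_(w in Y @^-1` D) (f (G w))%:E =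
    q%:E * \int[normal_prob 0 1]_x (f x)%:E)%E.
Proof.
move=> hG hYG mD q0 hq /measurable_EFinP mf f0.
have mYD : measurable (Y @^-1` D) by exact: measurable_funPTI.
have mG : measurable_fun setT (G : T -> measurableTypeR R).
  exact: (measurable_funPT G).
(* Independence says that [P] restricted to the event pushes forward along [G] to q times the normal
   law. *)
have -> : (\int[P]_(w in Y @^-1` D) (f (G w))%:E =
    \int[mrestr P mYD]_w (f (G w))%:E)%E.
  rewrite [RHS](ge0_negligible_integral (N := ~` (Y @^-1` D)))//.
  - rewrite setTD setCK; apply: eq_measure_integral => A mA AD.
    by rewrite /= /mrestr setIidl.
  - exact: measurableC.
  - exact: measurableT_comp mf mG.
  - by move=> w _; rewrite lee_fin.
  - by rewrite /= /mrestr setICl measure0.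
rewrite -(@ge0_integral_pushforward _ _ _ _ R _ mG (mrestr P mYD) setT
  (EFin \o f))//; last by move=> x _; rewrite lee_fin.
have -> : q = (NngNum q0)%:num by [].
rewrite -(@ge0_integral_mscale _ _ _ (normal_prob 0 1))//;
  last by move=> x _; rewrite lee_fin.
apply: eq_measure_integral => A mA _.
transitivity (P (Y @^-1` D `&` G @^-1` A)); first by congr (P _); exact: setIC.
by rewrite hYG// hq; congr (_ * _)%E; exact: hG.
Qed.

Lemma ge0_integral_standard_normal G (f : R -> R) : standard_normal G ->
  measurable_fun setT f -> (forall x, 0 <= f x) ->
  (\int[P]_w (f (G w))%:E = \int[normal_prob 0 1]_x (f x)%:E)%E.
Proof.
move=> hG /measurable_EFinP mf f0.
have mG : measurable_fun setT (G : T -> measurableTypeR R).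
  exact: (measurable_funPT G).
rewrite -(@ge0_integral_pushforward _ _ _ _ R _ mG P setT (EFin \o f))//;
  last by move=> x _; rewrite lee_fin.
by apply: eq_measure_integral => A mA _; exact: hG.
Qed.

Lemma g1E G (x : R) : standard_normal G -> g1 G x = relu1 x.
Proof.
move=> hG; rewrite /g1 unlock; congr fine.
rewrite -(ge0_integral_standard_normal _ _ hG)//.
  exact: measurable_pos_part_addr.
by move=> y; exact: pos_part_ge0.
Qed.

Lemma g1_invK G (x : R) : standard_normal G -> g1_inv G (relu1 x) = x.
Proof.
move=> hG; rewrite -(g1E _ _ hG) /g1_inv pinvKV ?inE//.
by move=> u v _ _; rewrite !g1E// => /relu1_inj.
Qed.

(** The two label events have total mass 1, so the integral splits over them; on each the margin is
    [G] plus a constant. *)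
Lemma expectation_margin Y G (p m tau kappa rho beta0 : R) :
  0 <= p <= 1 -> label_law p Y -> standard_normal G -> independent_RV Y G ->
  fine ('E_P[fun w => pos_part (margin_scale tau (Y w) * kappa - rho * m
                                + G w - beta0 * Y w) ^+ 2]) =
  p * relu2 (tau * kappa - rho * m - beta0) +
  (1 - p) * relu2 (kappa - rho * m + beta0).
Proof.
move=> /andP[p0 p1] [hY1 hYN] hG hYG; rewrite unlock.
have m1 : measurable (Y @^-1` [set 1]) by exact: measurable_funPTI.
have mN : measurable (Y @^-1` [set -1]) by exact: measurable_funPTI.
set F := fun w : T => _.
have mF : measurable_fun setT F.
  apply/measurable_EFinP/measurable_funX/measurableT_comp => //.
    exact: measurable_pos_part.
  have mY : measurable_fun setT (Y : T -> R) by [].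
  have mG : measurable_fun setT (G : T -> R) by [].
  apply: measurable_funB; last exact: measurable_funM.
  apply: measurable_funD => //; apply: measurable_funB => //.
  apply: measurable_funM => //; rewrite /margin_scale.
  by apply: measurable_fun_ifT => //; exact: measurable_fun_eqr.
have F0 w : (0 <= F w)%E by rewrite lee_fin sqr_ge0.
have dis : Y @^-1` [set 1] `&` Y @^-1` [set -1] = set0.
  by apply/seteqP; split => w //= -[-> /eqP]; rewrite -subr_eq0 opprK; lra.
pose D := Y @^-1` [set 1] `|` Y @^-1` [set -1].
have PD : P (~` D) = 0%E.
  rewrite probability_setC; last exact: measurableU.
  suff -> : P D = 1%E by rewrite subee.
  rewrite measureU//; transitivity (p%:E + (1 - p)%:E)%E.
    by congr (_ + _)%E; [exact: hY1|exact: hYN].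
  by rewrite -EFinD subrKC.
have mDC : measurable (~` D) by apply: measurableC; exact: measurableU.
rewrite (ge0_negligible_integral mDC measurableT mF (fun w _ => F0 w) PD).
rewrite setTD setCK ge0_integral_setU//; last 2 first.
- exact: measurable_funTS.
- exact/disj_set2P.
have sq x : measurable_fun setT (fun y : R => pos_part (y + x) ^+ 2).
  by apply: measurable_funX; exact: measurable_pos_part_addr.
have sq0 x y : 0 <= pos_part (y + x) ^+ 2 :> R by exact: sqr_ge0.
have int_label (y q x : R) : 0 <= q -> P (Y @^-1` [set y]) = q%:E ->
    margin_scale tau y * kappa - rho * m - beta0 * y = x ->
    (\int[P]_(w in Y @^-1` [set y]) F w = (q * relu2 x)%:E)%E.
  move=> q0 hq <-; rewrite EFinM /relu2 fineK; last first.
    by apply: integrable_fin_num => //; exact: integrable_relu2.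
  rewrite -(ge0_integral_standard_normal_on _ _ _ _ _ hG hYG _ q0 hq)//.
  apply: eq_integral => w; rewrite inE /F/= => ->.
  by congr ((pos_part _ ^+ 2)%:E); ring.
rewrite (int_label _ _ (tau * kappa - rho * m - beta0) p0 hY1); last first.
  by rewrite /margin_scale eqxx mulr1.
rewrite (int_label _ _ (kappa - rho * m + beta0) _ hYN) ?subr_ge0//.
by rewrite /margin_scale ifF ?mul1r ?mulrN1 ?opprK//; apply/negbTE/eqP; lra.
Qed.

End Expectations.

Lemma H_E (R : realType) (d : measure_display) (T : measurableType d)
    (P : probability T R) (Y G : {RV P >-> R}) (p m tau kappa rho beta0 : R) :
  0 <= p <= 1 -> label_law p Y -> standard_normal G -> independent_RV Y G ->
  H Y G m tau kappa rho beta0 =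
  (1 - rho ^+ 2) / (p * relu2 (tau * kappa - rho * m - beta0) +
                    (1 - p) * relu2 (kappa - rho * m + beta0)).
Proof. by move=> hp hY hG hYG; rewrite /H (expectation_margin _ _ _ p). Qed.

(** * From the margin program to the reduced program *)

Section SVM.
Context {R : realType} {d : measure_display} {T : measurableType d}.
Context (P : probability T R) (Y G : {RV P >-> R}) (p m delta : R).
Context (hp : 0 < p < 1) (hdelta : 0 < delta).
Context (hY : label_law p Y) (hG : standard_normal G) (hYG : independent_RV Y G).

Lemma margin_denominator_gt0 (a b : R) : 0 < p * relu2 a + (1 - p) * relu2 b.
Proof.
have /andP[p0 p1] := hp.
by apply: addr_gt0; apply: mulr_gt0; rewrite ?relu2_gt0 ?subr_gt0.
Qed.

Lemma svm_feasibleE (tau rho beta0 kappa : R) :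
  svm_feasible Y G m delta tau rho beta0 kappa <->
  budget (delta * p) (delta * (1 - p)) rho
    (tau * kappa - rho * m - beta0) (kappa - rho * m + beta0) <= 1.
Proof.
have /andP[p0 p1] := hp.
rewrite /svm_feasible (H_E _ _ _ _ _ _ p)//; last by rewrite !ltW.
have := margin_denominator_gt0 (tau * kappa - rho * m - beta0)
  (kappa - rho * m + beta0).
rewrite /budget; set a := relu2 _; set b := relu2 _ => D0.
rewrite ler_pdivlMr// lerBrDr.
have -> : delta * (p * a + (1 - p) * b) + rho ^+ 2 =
  delta * p * a + delta * (1 - p) * b + rho ^+ 2 by ring.
split=> [[]//|h]; split=> //.
(* The range of rho is recovered from the budget, whose [relu2] terms have positive sum. *)
have r1 : rho ^+ 2 <= 1.
  apply: le_trans h; rewrite lerDr.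
  by have := mulr_gt0 hdelta D0; lra.
by rewrite -ler_norml -(@expr_le1 _ 2)// real_normK ?num_real.
Qed.

Lemma svm_solution_reduced (tau rho beta0 kappa : R) : 0 < tau ->
  svm_solution Y G m delta tau rho beta0 kappa ->
  reduced_optimum (delta * p) (delta * (1 - p)) m rho
    (tau * kappa - rho * m - beta0) (kappa - rho * m + beta0).
Proof.
move=> tau0 [/svm_feasibleE feas opt]; split=> // rho' a' b' feas'.
(* For fixed rho', the change of variables is inverted: kappa' from the gain, then the intercept
   from b'. *)
pose kappa' := gain m rho' a' b' / (1 + tau).
have t1 : 0 < 1 + tau by rewrite addr_gt0.
have k' : kappa' * (1 + tau) = gain m rho' a' b' by rewrite divfK// gt_eqF.
have /opt : svm_feasible Y G m delta tau rho' (b' + rho' * m - kappa') kappa'.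
  apply/svm_feasibleE.
  have -> : tau * kappa' - rho' * m - (b' + rho' * m - kappa') = a'.
    transitivity (kappa' * (1 + tau) - b' - 2 * rho' * m); first by ring.
    by rewrite k' /gain; ring.
  by have -> : kappa' - rho' * m + (b' + rho' * m - kappa') = b' by ring.
move=> /(ler_wpM2r (ltW t1)); rewrite k' => /le_trans; apply.
by rewrite /gain; lra.
Qed.

(** Since [delta] is below [delta_star] at margin 0, some point of gain 0 has strict slack. Optima
    are tight, so the optimal gain [kappa * (1 + tau)] exceeds 0. *)
Lemma svm_margin_gt0 (tau rho beta0 kappa : R) : 0 < tau ->
  delta < delta_star Y G m tau 0 ->
  svm_solution Y G m delta tau rho beta0 kappa -> 0 < kappa.
Proof.
move=> tau0 dstar sol.
have /andP[p0 p1] := hp.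
have opt := svm_solution_reduced _ _ _ _ tau0 sol.
have A0 : 0 < delta * p by rewrite mulr_gt0.
have B0 : 0 < delta * (1 - p) by rewrite mulr_gt0 ?subr_gt0.
have [|_ [r r1 [b _ <-]]] := sup_gt _ dstar.
  by exists (H Y G m tau 0 0 0); exists 0 => //=;
    [rewrite in_itv/= lerN10 ler01|exists 0].
rewrite (H_E _ _ _ _ _ _ p)//; last by rewrite !ltW.
rewrite ltr_pdivlMr ?margin_denominator_gt0// !mulr0 !sub0r => slack.
pose a0 := - (r * m) - b; pose b0 := - (r * m) + b.
have lt1 : budget (delta * p) (delta * (1 - p)) r a0 b0 < 1.
  by move: slack; rewrite -/a0 -/b0 /budget; lra.
have g0 : gain m r a0 b0 = 0 by rewrite /gain /a0 /b0; ring.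
have t1 : 0 < 1 + tau by rewrite addr_gt0.
have gk : gain m rho (tau * kappa - rho * m - beta0) (kappa - rho * m + beta0) =
    kappa * (1 + tau) by rewrite /gain; ring.
rewrite -(pmulr_lgt0 _ t1) -gk lt_neqAle -{2}g0 (opt.2 _ _ _ (ltW lt1)) andbT.
apply/eqP => gk0.
have /reduced_optimum_tight :
    reduced_optimum (delta * p) (delta * (1 - p)) m r a0 b0.
  by split; [exact: ltW|move=> r' a' b' f'; rewrite g0 gk0; exact: opt.2].
by move=> /(_ A0 (ltW B0)) E; rewrite E ltxx in lt1.
Qed.

End SVM.

(* The map t |-> (t s - u) / (1 + t) has derivative (s + u) / (1 + t)^2 > 0, so
   it cannot attain its least absolute value at a nonzero value. *)
Lemma balanced_intercept_eq0 (R : realFieldType) (beta : R -> R) (s u tau : R) :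
  0 < tau -> 0 < s + u ->
  (forall t, 0 < t -> beta t * (1 + t) = t * s - u) ->
  (forall t, 0 < t -> ~~ (`|beta t| < `|beta tau|)) -> beta tau = 0.
Proof.
move=> tau0 K0 betaE opt; apply/eqP/negPn/negP => bn0.
set K := s + u in K0; set n := `|beta tau|.
have n0 : 0 < n by rewrite normr_gt0.
have nK : 0 < n + K * tau by rewrite addr_gt0// mulr_gt0.
(* This is half of 1 / (1 / tau + K / n), hence below both tau and n / K: tau stays positive after a
   move by h, and beta approaches 0 without crossing it. *)
pose h := tau * n / (2 * (n + K * tau)).
have h0 : 0 < h by rewrite !divr_gt0 ?mulr_gt0.
have Kh : 0 < K * h by rewrite mulr_gt0.
have htau : h < tau.
  by rewrite /h ltr_pdivrMr ?mulr_gt0// ltr_pM2l//; have := mulr_gt0 K0 tau0; lra.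
have hK : K * h < n.
  by rewrite /h mulrA ltr_pdivrMr ?mulr_gt0//; have := mulr_gt0 K0 tau0; nra.
have diff t : 0 < t ->
    (beta t - beta tau) * ((1 + t) * (1 + tau)) = K * (t - tau).
  move=> t0; transitivity
    (beta t * (1 + t) * (1 + tau) - beta tau * (1 + tau) * (1 + t)).
    by ring.
  by rewrite !betaE// /K; ring.
have W t : 0 < t -> 1 < (1 + t) * (1 + tau).
  by move=> t0; have := mulr_gt0 t0 tau0; lra.
have [bpos|bneg|b0] := ltrgt0P (beta tau); last by rewrite b0 eqxx in bn0.
- have t0 : 0 < tau - h by rewrite subr_gt0.
  apply/negP: (opt _ t0); have := diff _ t0; have := W _ t0.
  move: hK; rewrite /n (gtr0_norm bpos).
  move: (beta (tau - h)) ((1 + (tau - h)) * (1 + tau)) => x w hK w1 xw.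
  have w0 : 0 < w := lt_trans ltr01 w1.
  rewrite negbK ltr_norml; apply/andP; split; nra.
- have t0 : 0 < tau + h by rewrite addr_gt0.
  apply/negP: (opt _ t0); have := diff _ t0; have := W _ t0.
  move: hK; rewrite /n (ltr0_norm bneg).
  move: (beta (tau + h)) ((1 + (tau + h)) * (1 + tau)) => x w hK w1 xw.
  have w0 : 0 < w := lt_trans ltr01 w1.
  rewrite negbK ltr_norml; apply/andP; split; nra.
Qed.

Theorem proposition5p3 (R : realType) (d : measure_display)
    (T : measurableType d) (P : probability T R) (Y G : {RV P >-> R})
    (p m delta : R)
    (hp : 0 < p < 2^-1) (hm : 0 < m) (hdelta : 0 < delta)
    (hY : label_law p Y) (hG : standard_normal G) (hYG : independent_RV Y G)
    (hdelta_star : forall tau : R, 0 < tau -> delta < delta_star Y G m tau 0)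
    (rho beta0 kappa : R -> R)
    (hsol : forall tau : R, 0 < tau ->
       svm_solution Y G m delta tau (rho tau) (beta0 tau) (kappa tau))
    (tau_opt : R) (htau_opt : 0 < tau_opt)
    (hopt : forall tau : R, 0 < tau ->
       balanced_error m (rho tau_opt) (beta0 tau_opt) <=
       balanced_error m (rho tau) (beta0 tau)) :
  forall tau : R, 0 < tau ->
    tau_opt =
      (g1_inv G (rho tau / (2 * p * m * delta)) + rho tau * m) /
      (g1_inv G (rho tau / (2 * (1 - p) * m * delta)) + rho tau * m).
Proof.
have hp1 : 0 < p < 1 by have /andP[-> /lt_trans->] := hp; rewrite // invf_lt1 ?ltr1n.
have /andP[p0 p1] := hp1.
pose A := delta * p; pose B := delta * (1 - p).
have A0 : 0 < A by rewrite mulr_gt0.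
have B0 : 0 < B by rewrite mulr_gt0 ?subr_gt0.
pose a t := t * kappa t - rho t * m - beta0 t.
pose b t := kappa t - rho t * m + beta0 t.
have opt t : 0 < t -> reduced_optimum A B m (rho t) (a t) (b t).
  by move=> t0; exact: svm_solution_reduced (hsol t t0).
have const t : 0 < t -> [/\ rho t = rho tau_opt, a t = a tau_opt & b t = b tau_opt].
  by move=> t0; exact: reduced_optimum_unique (opt t t0) (opt _ htau_opt).
set r := rho tau_opt; set a0 := a tau_opt in const; set b0 := b tau_opt in const.
have [Ea Eb] : r = 2 * m * (A * relu1 a0) /\ r = 2 * m * (B * relu1 b0).
  by apply: reduced_optimum_gradient => //; exact: opt.
have r0 : 0 < r by rewrite Ea !mulr_gt0 ?relu1_gt0.
have rm0 : 0 < r * m by rewrite mulr_gt0.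
(* The sum equals [(1 + tau_opt) * kappa tau_opt]; it is the numerator of the derivative of the
   intercept in tau. *)
have K0 : 0 < a0 + b0 + 2 * (r * m).
  have : 0 < kappa tau_opt.
    apply: (@svm_margin_gt0 _ _ _ P Y G p m delta) (hdelta_star _ htau_opt)
      (hsol _ htau_opt) => //.
  by rewrite /a0 /b0 /a /b -/r; nra.
have beta_t t : 0 < t -> beta0 t * (1 + t) = t * (b0 + r * m) - (a0 + r * m).
  move=> t0; have [Er Ea' Eb'] := const t t0.
  by rewrite -Ea' -Eb' /r -Er /a /b; ring.
have beta_opt : beta0 tau_opt = 0.
  apply: (@balanced_intercept_eq0 _ beta0 (b0 + r * m) (a0 + r * m)) => //.
    by move: K0; lra.
  (* Since rho is the same at every t, a smaller intercept in absolute value would beat the minimal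
     error. *)
  move=> t t0; apply/negP => /(balanced_error_lt m r _ _ rm0).
  have [Er _ _] := const t t0.
  by apply/negP; rewrite -leNgt; have := hopt _ t0; rewrite Er.
have E : tau_opt * (b0 + r * m) = a0 + r * m.
  have := beta_t _ htau_opt; rewrite beta_opt mul0r => /esym/eqP.
  by rewrite subr_eq0 => /eqP.
(* If this vanished, so would a0 + r m by [E], contradicting the positive sum [K0]. *)
have bn0 : b0 + r * m != 0.
  by apply/eqP => b00; move: E K0; rewrite b00 mulr0; lra.
move=> t t0; have [-> _ _] := const t t0; rewrite -/r.
have -> : r / (2 * p * m * delta) = relu1 a0.
  by rewrite Ea /A; field; rewrite !gt_eqF.
have -> : r / (2 * (1 - p) * m * delta) = relu1 b0.
  by rewrite Eb /B; field; rewrite !gt_eqF ?subr_gt0.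
by rewrite !g1_invK// -E mulfK.
Qed.
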